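(* Let $\mathscr{L}$ be a semi-generic $C^1$ line bundle over a $C^1$ $d$-submanifold $M$ in $\mathbb{R}^n$, where $1 \leqslant d \leqslant n-1$. Then $\mathcal{L}^{d+1}(\Delta_* \mathscr{L}) > 0$. Moreover, if $M$ is a hypersurface (i.e. $d=n-1$) then $\operatorname{int}(\Delta_* \mathscr{L}) \neq \varnothing$.
   Context: Submanifolds of $\mathbb{R}^n$ carry the induced topology and are assumed connected; a $C^r$ $d$-submanifold is locally the graph (up to a rigid motion) of a $C^r$ map from an open subset of $\mathbb{R}^d$ to $\mathbb{R}^{n-d}$. A $C^1$ line bundle over $M$ means the embedded bundle $\mathscr{L}=\{(p,u)\in M\times\mathbb{R}^n: u\in\varphi(p)\}$ defined by a $C^1$ map $\varphi:M\to\mathbb{P}^{n-1}=\operatorname{Gr}_1(n)$ into the space of lines through $0$ in $\mathbb{R}^n$. The codiagonal map is $\Delta_*(x,y)=x+y$, so $\Delta_*\mathscr{L}=\bigcup_{p\in M}(p+\varphi(p))\subseteq\mathbb{R}^n$. $\mathscr{L}$ is tangent to $M$ (equivalently, is a $C^1$ line distribution on $M$) iff $\varphi(p)\subseteq T_pM$ for all $p\in M$. In that case $\mathscr{L}$ is integrable and equals $T\mathcal{F}$ for a regular $1$-dimensional foliation $\mathcal{F}$ of $M$ with $C^2$ leaves (the integral curves of $\mathscr{L}$). Such a tangent $\mathscr{L}$ is said to osculate $M$ at $p$ iff $T_p^2\gamma\subseteq T_pM$, where $\gamma\in\mathcal{F}$ is the leaf through $p$ and $T_p^2\gamma$ is the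 linear span of the first and second derivatives at $p$ of a regular $C^2$ parametrization of $\gamma$ as a curve in $\mathbb{R}^n$; it osculates $M$ iff it osculates $M$ at every $p\in M$. A $C^1$ line bundle over $M$ is semi-generic iff it is not tangent to $M$, or it is tangent to $M$ but does not osculate $M$. $\mathcal{L}^{m}$ denotes $m$-dimensional Lebesgue measure; for subsets of $\mathbb{R}^n$ with $m<n$ it is understood as $m$-dimensional volume (Hausdorff measure). $\operatorname{int}$ denotes interior in $\mathbb{R}^n$. *)

(* Defs.v *)
From mathcomp Require Export all_boot all_order all_algebra.
From mathcomp Require Export all_classical all_reals all_analysis.
Export numFieldNormedType.Exports.
Import Order.TTheory GRing.Theory Num.Theory.

Set Implicit Arguments.
Unset Strict Implicit.
Unset Printing Implicit Defensive.

Local Open Scope classical_set_scope.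
Local Open Scope ring_scope.

Definition C1_on {R : realType} {d k : nat} (U : set 'rV[R]_d)
    (f : 'rV[R]_d -> 'rV[R]_k) : Prop :=
  forall x, U x -> differentiable f x /\ {for x, continuous (jacobian f)}.

(* A rigid motion of R^n is y |-> a + y *m Q with Q orthogonal. Cutting Q into
   its first d rows A and its last n - d rows B, the image of the point
   (x, f x) of the graph of f is a + x *m A + f x *m B. This avoids a cast
   between 'rV_(d + (n - d)) and 'rV_n; for d > n there are no such A and B. *)
Definition graph_param {R : realType} {d n : nat} (M : set 'rV[R]_n)
    (U : set 'rV[R]_d) (psi : 'rV[R]_d -> 'rV[R]_n) : Prop :=
  [/\ open U,
      exists2 V : set 'rV[R]_n, open V & psi @` U = M `&` V
    & exists (a : 'rV[R]_n) (A : 'M[R]_(d, n)) (B : 'M[R]_(n - d, n))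
             (f : 'rV[R]_d -> 'rV[R]_(n - d)),
        [/\ A *m A^T = 1%:M, B *m B^T = 1%:M, A *m B^T = 0,
            C1_on U f & forall x, psi x = a + x *m A + f x *m B]].

Definition C1_submanifold {R : realType} {n : nat} (d : nat)
    (M : set 'rV[R]_n) : Prop :=
  connected M /\
  forall p, M p -> exists (U : set 'rV[R]_d) (psi : 'rV[R]_d -> 'rV[R]_n),
    graph_param M U psi /\ (psi @` U) p.

Definition tangent_space {R : realType} {n : nat} (d : nat)
    (M : set 'rV[R]_n) (p : 'rV[R]_n) : set 'rV[R]_n :=
  [set v | exists (U : set 'rV[R]_d) (psi : 'rV[R]_d -> 'rV[R]_n) (x : 'rV[R]_d),
     [/\ graph_param M U psi, U x, psi x = p & range ('d psi x) v]].

(* The projective space P^(n-1) of lines through 0 in R^n. *)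
Definition projspace (R : realType) (n : nat) : Type :=
  {L : {vspace 'rV[R]_n} | \dim L == 1%N}.

(* Standard affine atlas of P^(n-1): homogeneous coordinates [v_1 : ... : v_n],
   where v is any nonzero vector of the line, and on the domain v_i != 0 the
   chart (v_j / v_i)_j; its i-th component, constantly 1, is kept. *)
Definition affine_dom {R : realType} {n : nat} (i : 'I_n) :
    set (projspace R n) :=
  [set L | (vpick (val L) : 'rV[R]_n) ord0 i != 0].

Definition affine_chart {R : realType} {n : nat} (i : 'I_n)
    (L : projspace R n) : 'rV[R]_n :=
  let v : 'rV[R]_n := vpick (val L) in (v ord0 i)^-1 *: v.

(* phi is C^1 on M when it is so in the charts of M and of P^(n-1); values of
   phi outside M are irrelevant. The first conjunct expresses continuity of phi
   together with the second one. *)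
Definition C1_line_bundle {R : realType} {n : nat} (d : nat)
    (M : set 'rV[R]_n) (phi : 'rV[R]_n -> projspace R n) : Prop :=
  forall (U : set 'rV[R]_d) (psi : 'rV[R]_d -> 'rV[R]_n), graph_param M U psi ->
  forall i : 'I_n,
    let D := U `&` [set x | affine_dom i (phi (psi x))] in
    open D /\ C1_on D (fun x => affine_chart i (phi (psi x))).

Definition bundle {R : realType} {n : nat} (M : set 'rV[R]_n)
    (phi : 'rV[R]_n -> projspace R n) : set ('rV[R]_n * 'rV[R]_n) :=
  [set pu | M pu.1 /\ pu.2 \in val (phi pu.1)].

Definition codiagonal {R : realType} {n : nat}
    (xy : 'rV[R]_n * 'rV[R]_n) : 'rV[R]_n := xy.1 + xy.2.

Definition tangent_bundle_to {R : realType} {n : nat} (d : nat)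
    (M : set 'rV[R]_n) (phi : 'rV[R]_n -> projspace R n) : Prop :=
  forall p, M p -> [set` val (phi p)] `<=` tangent_space d M p.

(* c, restricted to ]a, b[, is a regular C^2 parametrization of an arc of a
   leaf, i.e. of an integral curve of the line distribution phi. *)
Definition leaf_param {R : realType} {n : nat} (M : set 'rV[R]_n)
    (phi : 'rV[R]_n -> projspace R n) (a b : R) (c : R -> 'rV[R]_n) : Prop :=
  forall t, a < t < b ->
    [/\ derivable c t 1, derivable (derive1 c) t 1
       & {for t, continuous (derive1n 2 c)}] /\
    [/\ M (c t), derive1 c t != 0 & derive1 c t \in val (phi (c t))].

(* The second osculating space does not depend on the parametrization c of the
   leaf around p, and the leaf through p exists and is unique when phi is C^1
   and tangent to M, the only case in which this notion is used. *)
Definition osculates_at {R : realType} {n : nat} (d : nat)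
    (M : set 'rV[R]_n) (phi : 'rV[R]_n -> projspace R n) (p : 'rV[R]_n) : Prop :=
  forall (a b t0 : R) (c : R -> 'rV[R]_n),
    leaf_param M phi a b c -> a < t0 < b -> c t0 = p ->
    [set` <<[:: derive1 c t0; derive1n 2 c t0]>>%VS] `<=` tangent_space d M p.

Definition osculates {R : realType} {n : nat} (d : nat)
    (M : set 'rV[R]_n) (phi : 'rV[R]_n -> projspace R n) : Prop :=
  forall p, M p -> osculates_at d M phi p.

Definition semi_generic {R : realType} {n : nat} (d : nat)
    (M : set 'rV[R]_n) (phi : 'rV[R]_n -> projspace R n) : Prop :=
  ~ tangent_bundle_to d M phi \/
  (tangent_bundle_to d M phi /\ ~ osculates d M phi).

(* The library norm on 'rV_n is the sup norm; volumes need the Euclidean one. *)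
Definition enorm {R : realType} {n : nat} (x : 'rV[R]_n) : R :=
  Num.sqrt (\sum_i x ord0 i ^+ 2).

(* Volume of the unit ball of R^m. *)
Fixpoint ball_volume (R : realType) (m : nat) : R :=
  match m with
  | 0 => 1
  | 1 => 2
  | k.+2 => 2 * pi / k.+2%:R * ball_volume R k
  end.

(* ball_volume m * (diam E / 2) ^ m, with value 0 for the empty set. *)
Definition hausdorff_gauge {R : realType} {n : nat} (m : nat)
    (E : set 'rV[R]_n) : \bar R :=
  ereal_sup (0%E |` [set z | exists x y, [/\ E x, E y &
    z = (ball_volume R m * (enorm (x - y) / 2) ^+ m)%:E]]).

Definition hausdorff_pre {R : realType} {n : nat} (m : nat) (delta : R)
    (A : set 'rV[R]_n) : \bar R :=
  ereal_inf [set (\sum_(0 <= k <oo) hausdorff_gauge m (E k))%E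
    | E in [set E : nat -> set 'rV[R]_n | A `<=` \bigcup_k E k /\
        forall k x y, E k x -> E k y -> enorm (x - y) <= delta]].

Definition hausdorff_measure {R : realType} {n : nat} (m : nat)
    (A : set 'rV[R]_n) : \bar R :=
  ereal_sup [set hausdorff_pre m delta A | delta in [set delta | 0 < delta]].

Definition box {R : realType} {n : nat} (a b : 'rV[R]_n) : set 'rV[R]_n :=
  [set x | forall i, a ord0 i <= x ord0 i <= b ord0 i].

(* Outer n-dimensional Lebesgue measure; the library only has the
   one-dimensional measure and its iterated products. *)
Definition lebesgue_outer {R : realType} {n : nat} (A : set 'rV[R]_n) : \bar R :=
  ereal_inf [set z | exists a b : nat -> 'rV[R]_n,
    [/\ forall k i, a k ord0 i <= b k ord0 i,
        A `<=` \bigcup_k box (a k) (b k)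
      & z = (\sum_(0 <= k <oo) (\prod_i (b k ord0 i - a k ord0 i))%:E)%E]].

(* m-dimensional volume in R^n, m <= n. *)
Definition volume {R : realType} {n : nat} (m : nat) (A : set 'rV[R]_n) : \bar R :=
  if m == n then lebesgue_outer A else hausdorff_measure m A.

(* Main.v *)
From HB Require Import structures.
Require Import Defs.
From mathcomp Require Import measurable_realfun ring lra.
Import Order.TTheory GRing.Theory Num.Theory.

(** Why the theorem holds.  Choose a graph chart [psi] of [M] on an open subset
of R^d and the affine chart of the projective space in which the bundle has a
C^1 section [g] over the chart.  The set swept by the lines contains the image
of the ruled map F(t, x) = psi x + t g(x), which has d + 1 real variables and
the jacobian

   dF(t, x) = (g(x) ; P + t V),    P = d psi(x), V = dg(x).

All that is needed is one point at which this matrix has rank d + 1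
([full_rank_ruling]).

If the bundle is not tangent to [M], then at some point g(x) is not in the row
space of P, which is the tangent space, and t = 0 will do.  If it is tangent but
does not osculate, take a leaf c through a point where c'' is not tangent.  It
lifts to a curve of the chart with velocity h, so that c' = l g(x) = h P with
l <> 0; differentiating c' = l g once more gives c'' = l' g + l h V
([leaf_second_derivative]), whence h V is not tangent.  At (t, x) the direction
h is then sent to l g(x) + t h V, and for small t <> 0 the vectors g(x), h V and
the images of the other directions are independent, being close to g(x), h V and
the corresponding tangent vectors.  [row_free_ruling] makes this quantitative
without choosing a basis.

At a point of full rank two things follow from C^1 regularity, used in the form
of strict differentiability.  When d + 1 = n, the Newton iteration contracts, so
F is locally onto and the image has interior points
([strictly_differentiable_open_image]).  In general F does not shrink distances
by more than a constant factor ([strictly_differentiable_expanding]), so a cover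
of the image pulls back to a cover of a cube of R^(d+1) by cubes whose volumes
are controlled by the Hausdorff gauges ([hausdorff_measure_gt0]).  Both measures
are then bounded below by one fact: boxes covering a box have at least its
volume in total ([box_cover_le]). *)

Set Implicit Arguments.
Unset Strict Implicit.
Unset Printing Implicit Defensive.

Local Open Scope classical_set_scope.
Local Open Scope ring_scope.

(** * Sup norm and matrix products *)

Lemma mx_coord_le (R : realType) m n (A : 'M[R]_(m, n)) i j : `|A i j| <= `|A|.
Proof. by rewrite [leRHS]/Num.Def.normr/= mx_normrE; exact: (le_bigmax _ _ (i, j)). Qed.

Lemma mx_norm_le (R : realType) m n (A : 'M[R]_(m, n)) e :
  0 <= e -> (forall i j, `|A i j| <= e) -> `|A| <= e.
Proof.
move=> e0 h; rewrite [leLHS]/Num.Def.normr/= mx_normrE.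
by apply: bigmax_le => // -[i j] _; exact: h.
Qed.

Lemma mulmx_norm_le (R : realType) m p q (A : 'M[R]_(m, p)) (B : 'M[R]_(p, q)) :
  `|A *m B| <= p%:R * `|B| * `|A|.
Proof.
apply: mx_norm_le => [|i j]; first by rewrite !mulr_ge0.
rewrite mxE (le_trans (ler_norm_sum _ _ _))//.
rewrite -mulrA mulr_natl -[X in _ *+ X]card_ord -sumr_const ler_sum// => k _.
by rewrite normrM mulrC ler_pM// mx_coord_le.
Qed.

Lemma rsubmx_norm_le (R : realType) d (z : 'rV[R]_(1 + d)) : `|rsubmx z| <= `|z|.
Proof. by apply: mx_norm_le => // i j; rewrite mxE mx_coord_le. Qed.

Lemma mulmxr_continuous (R : realType) p q (J : 'M[R]_(p, q)) :
  continuous (fun h : 'rV[R]_p => h *m J).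
Proof.
move=> x; apply/(@cvgrPdist_le _ _ _ _ (nbhs_filter x)) => /= e e0.
have C0 : 0 < p%:R * `|J| + 1 by rewrite ltr_wpDl// mulr_ge0.
near=> y; rewrite -mulmxBl (le_trans (mulmx_norm_le _ _))//.
apply: (@le_trans _ _ ((p%:R * `|J| + 1) * `|x - y|)).
  by rewrite ler_wpM2r// lerDl.
rewrite -ler_pdivlMl//; near: y.
have : id y @[y --> x] --> x by exact: cvg_id.
by move/cvgrPdist_le; apply; rewrite mulr_gt0// invr_gt0.
Unshelve. all: by end_near. Qed.

(** * Strict differentiability *)

(** Comparing two moving points, rather than one moving point with [x0], is what
gives injectivity and contraction near [x0].  A C^1 map has this property at
every point, and sums and products preserve it. *)
Definition strictly_differentiable_at (R : realType) p q
    (f : 'rV[R]_p -> 'rV[R]_q) (x0 : 'rV[R]_p) (J : 'M[R]_(p, q)) :=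
  forall e, 0 < e -> exists2 r, 0 < r & forall x y,
    `|x - x0| <= r -> `|y - x0| <= r ->
    `|f x - f y - (x - y) *m J| <= e * `|x - y|.

Lemma is_derive_line (R : realType) (V : normedModType R) (y w : V) (s : R) :
  is_derive s (1 : R) (fun s : R => y + s *: w) w.
Proof.
have dl : is_diff s (fun s : R => y + s *: w) ( *:%R^~ w).
  rewrite -[( *:%R^~ w)]add0r.
  exact: (@is_diffD R R V (cst y) (fun s : R => s *: w) 0).
apply: DeriveDef; first by apply/derivable1_diffP; exact: ex_diff.
by rewrite deriveE ?diff_val ?scale1r//; exact: ex_diff.
Qed.

(** The intermediate point depends on the coordinate [j]: there is no mean value
equality for vector valued maps. *)
Lemma mean_value_coord (R : realType) p q (f : 'rV[R]_p -> 'rV[R]_q) x y j :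
  (forall s : R, 0 <= s <= 1 -> differentiable f (y + s *: (x - y))) ->
  exists2 s, 0 <= s <= 1 &
    (f x - f y) 0 j = ((x - y) *m jacobian f (y + s *: (x - y))) 0 j.
Proof.
move=> df.
pose l (s : R) := y + s *: (x - y).
have dl (s : R) : is_derive s (1 : R) l (x - y) by exact: is_derive_line.
have dg (s : R) : 0 <= s <= 1 ->
   is_derive s (1 : R) (fun s => f (l s) 0 j) (((x - y) *m jacobian f (l s)) 0 j).
  move=> s01; have dfs := df s s01.
  have dls : differentiable l s by apply/derivable1_diffP; exact: ex_derive.
  have dfl : differentiable (f \o l) s by exact: differentiable_comp.
  have dfl1 : derivable (f \o l) s 1 by exact/derivable1_diffP.
  apply: DeriveDef; first exact: (derivable_mxP _ _ _).1.
  have /matrixP/(_ 0 j) := derive_mx dfl1; rewrite mxE => <-.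
  have dl1 : 'd l s 1 = x - y.
    by rewrite -deriveE//; exact: (@derive_val _ _ _ _ _ _ _ (dl s)).
  rewrite deriveE// diff_comp//= dl1.
  by rewrite -deriveEjacobian// deriveE.
have [s||s s01] := @MVT_segment R (fun s => f (l s) 0 j)
  (fun s => ((x - y) *m jacobian f (l s)) 0 j) 0 1 ler01.
- by rewrite in_itv/= => /andP[s0 s1]; apply: dg; rewrite !ltW.
- apply: derivable_within_continuous => s; rewrite in_itv/= => s01.
  by have [] := dg s s01.
rewrite /l scale0r scale1r addr0 subr0 mulr1 subrKC => E.
by exists s; [by move: s01; rewrite in_itv|rewrite -E !mxE].
Qed.

(** Near [x0] the jacobian differs little from its value at [x0]; the mean value
theorem on the segment from [y] to [x] turns this into the two-point estimate. *)
Lemma C1_strictly_differentiable (R : realType) p q (U : set 'rV[R]_p)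
    (f : 'rV[R]_p -> 'rV[R]_q) x0 :
  open U -> C1_on U f -> U x0 ->
  strictly_differentiable_at f x0 (jacobian f x0).
Proof.
move=> oU cf Ux0 e e0.
have [_ cj] := cf _ Ux0.
have e'0 : 0 < e / (p%:R + 1) by rewrite divr_gt0// ltr_wpDl.
have : \forall x \near x0, U x /\ `|jacobian f x0 - jacobian f x| <= e / (p%:R + 1).
  near=> x; split; near: x; first exact: open_nbhs_nbhs.
  by move/cvgrPdist_le : cj => /(_ _ e'0).
case/nbhs_closedballP => r rP.
exists r%:num => // x y xr yr.
have seg s : 0 <= s <= 1 -> closed_ball x0 r%:num (y + s *: (x - y)).
  move=> /andP[s0 s1]; rewrite closed_ballE// /closed_ball_/=.
  have -> : x0 - (y + s *: (x - y)) = - (s *: (x - x0) + (1 - s) *: (y - x0)).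
    by apply/rowP => i; rewrite !mxE; ring.
  rewrite normrN (le_trans (ler_normD _ _))// !normrZ !ger0_norm ?subr_ge0//.
  have -> : r%:num = s * r%:num + (1 - s) * r%:num by ring.
  by rewrite lerD// ler_wpM2l// subr_ge0.
apply: mx_norm_le => [|i j]; first by rewrite mulr_ge0// ltW.
rewrite (ord1 i).
have [|s s01] := @mean_value_coord R p q f x y j.
  by move=> s /seg /rP [/cf[]].
rewrite [X in `|X|]mxE => ->; rewrite [X in _ + X]mxE.
set J := jacobian f _; set J0 := jacobian f x0.
have -> : ((x - y) *m J) 0 j - ((x - y) *m J0) 0 j = ((x - y) *m (J - J0)) 0 j.
  by rewrite mulmxBr [RHS]mxE [X in _ = _ + X]mxE.
have [_ Je] := rP _ (seg _ s01).
rewrite (le_trans (mx_coord_le _ _ _))// (le_trans (mulmx_norm_le _ _))//.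
rewrite ler_wpM2r// distrC (le_trans (ler_wpM2l _ Je))//.
by rewrite mulrCA ler_piMr ?(ltW e0)// ler_pdivrMr ?mul1r ?lerDl// ltr_wpDl.
Unshelve. all: by end_near. Qed.

Lemma strictly_differentiable_littleo (R : realType) p q
    (f : 'rV[R]_p -> 'rV[R]_q) x0 J :
  strictly_differentiable_at f x0 J ->
  f \o shift x0 = cst (f x0) + (fun h => h *m J) +o_ (0 : 'rV[R]_p) id.
Proof.
move=> sf; apply/eqaddoP => e e0; have [r r0 hr] := sf _ e0.
near=> h; rewrite /= !fctE /shift/= opprD addrA.
have := hr (h + x0) x0; rewrite addrK subrr normr0; apply; last by exact: ltW.
near: h.
have : id y @[y --> (0 : 'rV[R]_p)] --> (0 : 'rV[R]_p) by exact: cvg_id.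
by move/cvgr0Pnorm_le; apply.
Unshelve. all: by end_near. Qed.

Lemma strictly_differentiable_diff (R : realType) p q
    (f : 'rV[R]_p -> 'rV[R]_q) x0 J :
  strictly_differentiable_at f x0 J ->
  'd f x0 = (fun h => h *m J) :> ('rV[R]_p -> 'rV[R]_q).
Proof.
move=> sf; apply: (diff_unique (df := mulmxr J)).
  exact: mulmxr_continuous.
exact: strictly_differentiable_littleo.
Qed.

Lemma strictly_differentiable_differentiable (R : realType) p q
   (f : 'rV[R]_p -> 'rV[R]_q) x0 J :
  strictly_differentiable_at f x0 J -> differentiable f x0.
Proof.
move=> sf; apply/diff_locallyP; rewrite (strictly_differentiable_diff sf).
split; first exact: mulmxr_continuous.
exact: strictly_differentiable_littleo.
Qed.

Lemma affine_strictly_differentiable (R : realType) p q (a : 'rV[R]_p)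
    (Q : 'M[R]_(p, q)) x0 :
  strictly_differentiable_at (fun y => (y - a) *m Q) x0 Q.
Proof.
move=> e e0; exists 1 => // x y _ _.
have -> : (x - a) *m Q - (y - a) *m Q - (x - y) *m Q = 0.
  rewrite !mulmxBl; move: (_ *m Q) (_ *m Q) (_ *m Q) => u v w.
  by apply/rowP => i; rewrite !mxE; ring.
by rewrite normr0 mulr_ge0 ?(ltW e0).
Qed.

Lemma derive_curve_comp (R : realType) p q (f : 'rV[R]_p -> 'rV[R]_q) J
    (x : R -> 'rV[R]_p) (t : R) :
  derivable x t 1 -> strictly_differentiable_at f (x t) J ->
  derivable (f \o x) t 1 /\ derive1 (f \o x) t = derive1 x t *m J.
Proof.
move=> dx sf; have df := strictly_differentiable_differentiable sf.
have dx' : differentiable x t by apply/derivable1_diffP.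
have dfx : differentiable (f \o x) t by exact: differentiable_comp.
split; first exact/derivable1_diffP.
by rewrite !derive1E' // diff_comp//= (strictly_differentiable_diff sf).
Qed.

Lemma derive_curveZ (R : realType) n (l : R -> R) (w : R -> 'rV[R]_n) (t : R) :
  derivable l t 1 -> derivable w t 1 ->
  derive1 (fun s => l s *: w s) t = derive1 l t *: w t + l t *: derive1 w t.
Proof.
move=> dl dw; rewrite !derive1E.
have dwj i j : derivable (fun s => w s i j) t 1 := (derivable_mxP _ _ _).1 dw i j.
have lwE i j : l \* (fun s => w s i j) = (fun s => (l s *: w s) i j).
  by apply/funext => s; rewrite mxE.
have dlwj i j : derivable (fun s => (l s *: w s) i j) t 1.
  by rewrite -lwE; exact: derivableM dl (dwj i j).
have dlw : derivable (fun s => l s *: w s) t 1 := (derivable_mxP _ _ _).2 dlwj.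
rewrite (derive_mx dlw) (derive_mx dw); apply/matrixP => i j.
have E := deriveM dl (dwj i j).
rewrite !mxE -lwE [LHS]E.
by rewrite addrC; congr (_ + _); rewrite mulrC.
Qed.

(** The line coordinate [t] comes first, so that the source is 'rV_(1 + d), which
is convertible to 'rV_d.+1. *)
Definition ruled (R : realType) d n (f g : 'rV[R]_d -> 'rV[R]_n)
    (z : 'rV[R]_(1 + d)) : 'rV[R]_n :=
  f (rsubmx z) + lsubmx z 0 0 *: g (rsubmx z).

(** The remainder t (g x - g x') + (t - t') g x' splits into the linear part, the
remainder of [g], and two products of small increments, which are the reason for
the bound on [r] that involves [2 * C + e1]. *)
Lemma ruled_strictly_differentiable (R : realType) d n
    (f g : 'rV[R]_d -> 'rV[R]_n) x0 P V (t0 : R) :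
  strictly_differentiable_at f x0 P -> strictly_differentiable_at g x0 V ->
  strictly_differentiable_at (ruled f g) (row_mx t0%:M x0)
    (col_mx (g x0) (P + t0 *: V)).
Proof.
move=> sf sg e e0.
pose C := d%:R * `|V|.
have C0 : 0 <= C by rewrite mulr_ge0.
(* The total error is e1 * (|t0| + 2) + r * (2 * C + e1) times the increment;
   each summand is at most half of [e]. *)
pose e1 := e / (2 * (`|t0| + 2)).
have e10 : 0 < e1 by rewrite divr_gt0// mulr_gt0// ltr_wpDl.
have [rf rf0 hf] := sf _ e10; have [rg rg0 hg] := sg _ e10.
have D0 : 0 < 2 * C + e1 by rewrite ltr_wpDl// mulr_ge0.
pose r := Num.min (Num.min rf rg) (Num.min 1 (e / 2 / (2 * C + e1))).
have r0 : 0 < r by rewrite !lt_min rf0 rg0 ltr01/= !divr_gt0.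
exists r => // z z' zr zr'.
set t := lsubmx z 0 0; set t' := lsubmx z' 0 0.
set x := rsubmx z; set x' := rsubmx z'.
have tE (w : 'rV[R]_(1 + d)) : lsubmx (w - row_mx t0%:M x0) 0 0 = lsubmx w 0 0 - t0.
  by rewrite raddfB/= row_mxKl !mxE eqxx mulr1n.
have xE (w : 'rV[R]_(1 + d)) : rsubmx (w - row_mx t0%:M x0) = rsubmx w - x0.
  by rewrite raddfB/= row_mxKr.
have tr : `|t - t0| <= r.
  by rewrite -tE (le_trans _ zr)// mxE mx_coord_le.
have xr : `|x - x0| <= r by rewrite -xE (le_trans (rsubmx_norm_le _)).
have xr' : `|x' - x0| <= r by rewrite -xE (le_trans (rsubmx_norm_le _)).
have : r <= r by [].
rewrite {2}/r !le_min => /andP[/andP[rrf rrg] /andP[r1 re]].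
have hfx := hf x x' (le_trans xr rrf) (le_trans xr' rrf).
have hgx := hg x x' (le_trans xr rrg) (le_trans xr' rrg).
have := hg x' x0 (le_trans xr' rrg).
rewrite subrr normr0 => /(_ (ltW rg0)) hg0.
have dx : `|x - x'| <= `|z - z'| by rewrite /x /x' -raddfB; exact: rsubmx_norm_le.
have dt : `|t - t'| <= `|z - z'|.
  by rewrite (_ : t - t' = (z - z') 0 (lshift d 0)) ?mx_coord_le// /t /t' !mxE.
have g0 : `|g x' - g x0| <= (e1 + C) * r.
  rewrite -[X in `|X|](subrK ((x' - x0) *m V)) (le_trans (ler_normD _ _))//.
  rewrite mulrDl lerD// ?(le_trans hg0) ?ler_pM2l//.
  by rewrite (le_trans (mulmx_norm_le _ _))// ler_wpM2l.
have -> : ruled f g z - ruled f g z' - (z - z') *m col_mx (g x0) (P + t0 *: V) =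
  (f x - f x' - (x - x') *m P) + t *: (g x - g x' - (x - x') *m V) +
  (t - t0) *: ((x - x') *m V) + (t - t') *: (g x' - g x0).
  rewrite -[z - z']hsubmxK mul_row_col !raddfB/= -/x -/x' /ruled -/t -/t' -/x -/x'.
  rewrite [lsubmx z]mx11_scalar [lsubmx z']mx11_scalar -/t -/t' -raddfB mul_scalar_mx.
  rewrite mulmxDr -scalemxAr; move: (_ *m P) (_ *m V) => p q.
  by apply/rowP => i; rewrite !mxE; ring.
set N := `|z - z'| in dx dt *.
have N0 : 0 <= N by exact: normr_ge0.
have tb : `|t| <= `|t0| + 1.
  by rewrite -[t](subrK t0) addrC (le_trans (ler_normD _ _))// lerD2l (le_trans tr).
apply: (@le_trans _ _ (e1 * N + (`|t0| + 1) * (e1 * N) + r * (C * N) + N * ((e1 + C) * r))).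
  rewrite (le_trans (ler_normD _ _))// lerD//; last by rewrite normrZ ler_pM.
  rewrite (le_trans (ler_normD _ _))// lerD//; last first.
    rewrite normrZ ler_pM// (le_trans (mulmx_norm_le _ _))// ler_wpM2l//.
  rewrite (le_trans (ler_normD _ _))// lerD//.
    by rewrite (le_trans hfx)// ler_pM2l.
  by rewrite normrZ ler_pM// (le_trans hgx)// ler_pM2l.
have -> : e1 * N + (`|t0| + 1) * (e1 * N) + r * (C * N) + N * ((e1 + C) * r) =
  (e1 * (`|t0| + 2) + r * (2 * C + e1)) * N by ring.
rewrite ler_wpM2r// (splitr e) lerD//; last by rewrite -ler_pdivlMr.
rewrite /e1 invfM mulrA mulfVK// gt_eqF// ltr_wpDl//.
Qed.

(** * Covering a box by boxes *)

Definition box_volume (R : realType) n (a b : 'rV[R]_n) : R :=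
  \prod_i (b ord0 i - a ord0 i).

Lemma box_volume_ge0 (R : realType) n (a b : 'rV[R]_n) :
  (forall i, a ord0 i <= b ord0 i) -> 0 <= box_volume a b.
Proof. by move=> ab; apply: prodr_ge0 => i _; rewrite subr_ge0. Qed.

Lemma box_volumeS (R : realType) n (a b : 'rV[R]_(1 + n)) :
  box_volume a b = (b ord0 (lshift n ord0) - a ord0 (lshift n ord0)) *
     box_volume (rsubmx a) (rsubmx b).
Proof.
rewrite /box_volume (@big_split_ord _ _ _ 1 n) big_ord1/=; congr (_ * _).
by apply: eq_bigr => i _; rewrite !mxE.
Qed.

Lemma box_row_mx (R : realType) n (a b : 'rV[R]_(1 + n)) (s : R) (y : 'rV[R]_n) :
  box a b (row_mx s%:M y) <->
  a ord0 (lshift n ord0) <= s <= b ord0 (lshift n ord0) /\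
  box (rsubmx a) (rsubmx b) y.
Proof.
split=> [h|[hs hy] i].
  split; first by have := h (lshift n ord0); rewrite row_mxEl mxE eqxx mulr1n.
  by move=> i; have := h (rshift 1 i); rewrite row_mxEr !mxE.
case: (split_ordP i) => j ->.
  by rewrite (ord1 j) row_mxEl mxE eqxx mulr1n.
by rewrite row_mxEr; have := hy j; rewrite !mxE.
Qed.

(** Induction on the dimension: the slice of the big box at height [s] is covered
by the slices of the boxes whose first side contains [s], and integrating the
resulting inequality over [s] gives back the missing factor.  The predicate [P]
is there for this induction, since a box that misses the slice has to be left
out; in dimension 0 every box has volume 1. *)
Lemma box_cover_le (R : realType) n (a b : 'rV[R]_n) (P : pred nat)
    (ak bk : nat -> 'rV[R]_n) :
  (forall i, a ord0 i <= b ord0 i) ->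
  (forall k i, ak k ord0 i <= bk k ord0 i) ->
  (forall x, box a b x -> exists2 k, P k & box (ak k) (bk k) x) ->
  ((box_volume a b)%:E <= \sum_(0 <= k <oo | P k) (box_volume (ak k) (bk k))%:E)%E.
Proof.
elim: n a b P ak bk => [|n IH].
  move=> a b P ak bk _ _ cov; have [|k Pk _] := cov 0; first by case.
  have V1 (x y : 'rV[R]_0) : box_volume x y = 1 by rewrite /box_volume big_ord0.
  under eq_eseriesr do rewrite V1.
  rewrite V1; apply: le_trans (nneseries_lim_ge k.+1 _) => //=.
  rewrite big_mkcond/= big_nat_recr//= Pk leeDr// sume_ge0// => i _.
  by case: ifP; rewrite ?lee_fin.
rewrite -[n.+1]/(1 + n)%N => a b P ak bk ab abk cov.
pose l := lshift n (ord0 : 'I_1).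
pose I k : set (measurableTypeR R) := `[ak k ord0 l, bk k ord0 l]%classic.
pose V k := box_volume (rsubmx (ak k)) (rsubmx (bk k)).
pose V0 := box_volume (rsubmx a) (rsubmx b).
have V_ge0 k : 0 <= V k by apply: box_volume_ge0 => i; rewrite !mxE.
have V0_ge0 : 0 <= V0 by apply: box_volume_ge0 => i; rewrite !mxE.
pose mu : {measure set (measurableTypeR R) -> \bar R} := @lebesgue_measure R.
pose D : set (measurableTypeR R) := `[a ord0 l, b ord0 l]%classic.
have mI k : measurable (I k) by exact: measurable_itv.
have mD : measurable D by exact: measurable_itv.
have muitv (x y : R) : x <= y -> mu (`[x, y]%classic : set (measurableTypeR R)) = (y - x)%:E.
  move=> xy; apply: (etrans (lebesgue_measure_itv `[x, y])); rewrite /= lte_fin.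
  case: ltP => // yx; have -> : y = x by apply/eqP; rewrite eq_le xy yx.
  by rewrite subrr.
pose F k (s : measurableTypeR R) : \bar R := if P k then ((V k)%:E * (\1_(I k) s)%:E)%E else 0%E.
have F_ge0 k s : (0 <= F k s)%E.
  by rewrite /F; case: ifP => // _; rewrite mule_ge0// lee_fin.
have mF k : measurable_fun D (F k).
  rewrite /F; case: (P k); last exact: measurable_cst.
  apply: emeasurable_funM; first exact: measurable_cst.
  by apply/measurable_EFinP; exact: measurable_indic.
have slice s : D s -> (V0%:E <= \sum_(0 <= k <oo) F k s)%E.
  rewrite /D /= in_itv/= => Ds.
  have := IH (rsubmx a) (rsubmx b) [pred k | P k && (ak k ord0 l <= s <= bk k ord0 l)]
     (fun k => rsubmx (ak k)) (fun k => rsubmx (bk k)).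
  have h : forall i, (rsubmx a : 'rV_n) ord0 i <= (rsubmx b : 'rV_n) ord0 i.
    by move=> i; rewrite !mxE.
  move=> /(_ h); have {}h : forall k i,
      (rsubmx (ak k) : 'rV_n) ord0 i <= (rsubmx (bk k) : 'rV_n) ord0 i.
    by move=> k i; rewrite !mxE.
  move=> /(_ h); have {}h : forall x, box (rsubmx a) (rsubmx b) x ->
      exists2 k, [pred k | P k && (ak k ord0 l <= s <= bk k ord0 l)] k &
         box (rsubmx (ak k)) (rsubmx (bk k)) x.
    move=> y yb; have [|k Pk /box_row_mx[ks kb]] := cov (row_mx s%:M y).
      by apply/box_row_mx.
    by exists k => //=; rewrite Pk.
  move=> /(_ h) /le_trans; apply.
  rewrite eseries_mkcond; apply: lee_nneseries => [k _ _|k _].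
    by case: ifP => // _; rewrite lee_fin; exact: V_ge0.
  rewrite /F /=; case: (P k) => //=; case: ifP => [sI|_].
    by rewrite indicE mem_set ?mule1// /I /= in_itv.
  by rewrite mule_ge0// lee_fin.
have -> : (box_volume a b)%:E = (\int[mu]_(s in D) V0%:E)%E.
  by rewrite integral_cst// [mu D]muitv ?ab// box_volumeS EFinM muleC.
apply: (@le_trans _ _ (\int[mu]_(s in D) (\sum_(0 <= k <oo) F k s))%E).
  apply: ge0_le_integral => //.
  - exact: ge0_emeasurable_sum.
rewrite integral_nneseries// [leRHS]eseries_mkcond.
apply: lee_nneseries => [k _ _|k _]; first exact: integral_ge0.
rewrite /F; case: (P k); last by rewrite integral0.
rewrite ge0_integralZl ?lee_fin//; last first.
  by apply/measurable_EFinP; exact: measurable_indic.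
rewrite integral_indic// box_volumeS -/(V k) -/l mulrC EFinM lee_wpmul2l ?lee_fin//.
apply: (@le_trans _ _ (mu (I k))).
  by apply: le_measure; rewrite ?inE//; exact: measurableI.
by rewrite [mu _]muitv.
Qed.

Lemma lebesgue_outer_gt0 (R : realType) n (A : set 'rV[R]_n) :
  interior A !=set0 -> (0 < lebesgue_outer A)%E.
Proof.
case=> p /nbhs_closedballP[r rA].
pose e : 'rV[R]_n := const_mx r%:num.
apply: (@lt_le_trans _ _ (box_volume (p - e) (p + e))%:E).
  rewrite lte_fin; apply: prodr_gt0 => i _; rewrite !mxE.
  by rewrite opprD addrACA subrr add0r opprK addr_gt0.
apply: le_ereal_inf_tmp => _ [a [b [ab cov ->]]].
apply: box_cover_le => // [i|x xb].
  by rewrite !mxE lerD2l ge0_cp.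
have [|k _ xk] := cov x; last by exists k.
apply: rA; rewrite closed_ballE// /closed_ball_/= distrC.
apply: mx_norm_le => // i j; rewrite (ord1 i) !mxE ler_distl.
by have := xb j; rewrite !mxE.
Qed.

(** * Lower bound for the Hausdorff measure *)

Lemma norm_le_enorm (R : realType) n (x : 'rV[R]_n) : `|x| <= enorm x.
Proof.
apply: mx_norm_le => [|i j]; first exact: sqrtr_ge0.
rewrite (ord1 i) -sqrtr_sqr ler_wsqrtr// (bigD1 j)//= lerDl sumr_ge0// => k _.
exact: sqr_ge0.
Qed.

Lemma ball_volume_gt0 (R : realType) m : 0 < ball_volume R m.
Proof.
have [k] := ubnP m; elim: k m => // k IH [|[|m]] mk //=.
by apply: mulr_gt0; [rewrite divr_gt0 ?mulr_gt0 ?pi_gt0|exact/IH/ltnW].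
Qed.

Lemma hausdorff_gauge_real (R : realType) n m (delta : R) (E : set 'rV[R]_n) :
  (forall x y, E x -> E y -> enorm (x - y) <= delta) ->
  exists g : R, [/\ hausdorff_gauge m E = g%:E, 0 <= g &
    forall x y, E x -> E y ->
      ball_volume R m * (enorm (x - y) / 2) ^+ m <= g].
Proof.
move=> Ed; have bv := ltW (ball_volume_gt0 R m).
have g0 : (0 <= hausdorff_gauge m E)%E by apply: ereal_sup_ubound; left.
have gub x y : E x -> E y ->
    ((ball_volume R m * (enorm (x - y) / 2) ^+ m)%:E <= hausdorff_gauge m E)%E.
  by move=> Ex Ey; apply: ereal_sup_ubound; right; exists x, y.
have gle : (hausdorff_gauge m E <= (ball_volume R m * (`|delta| / 2) ^+ m)%:E)%E.
  apply: ge_ereal_sup => _ [->|[x [y [Ex Ey ->]]]]; rewrite lee_fin.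
    by rewrite mulr_ge0// exprn_ge0// divr_ge0.
  rewrite ler_wpM2l// lerXn2r ?nnegrE ?divr_ge0// ?sqrtr_ge0//.
  by rewrite ler_pM2r ?invr_gt0// (le_trans (Ed _ _ Ex Ey))// ler_norm.
move: g0 gub gle; case: (hausdorff_gauge m E) => [g| |] //= g0 gub gle.
by exists g.
Qed.

(** The part of the ball that [f] sends into the k-th covering set lies in a cube
of half side [C * a k], where [a k] is the diameter for which the gauge would be
exactly [g k].  The m-th power of [a k] is proportional to [g k], so
[box_cover_le] applied to these cubes bounds the sum of the gauges from below. *)
Lemma hausdorff_measure_gt0 (R : realType) m n (f : 'rV[R]_m -> 'rV[R]_n)
    z0 (C r : R) (S : set 'rV[R]_n) :
  (0 < m)%N -> 0 < C -> 0 < r ->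
  (forall z z', `|z - z0| <= r -> `|z' - z0| <= r ->
     `|z - z'| <= C * `|f z - f z'|) ->
  (forall z, `|z - z0| <= r -> S (f z)) ->
  (0 < hausdorff_measure m S)%E.
Proof.
move=> m0 C0 r0 fC fS; have bv := ball_volume_gt0 R m.
pose e : 'rV[R]_m := const_mx r.
pose V := box_volume (z0 - e) (z0 + e).
have V0 : 0 < V.
  by apply: prodr_gt0 => i _; rewrite !mxE opprD addrACA subrr add0r opprK addr_gt0.
pose c := (4 * C) ^+ m / ball_volume R m.
have c0 : 0 < c by rewrite divr_gt0// exprn_gt0// mulr_gt0.
apply: (@lt_le_trans _ _ (V / c)%:E); first by rewrite lte_fin divr_gt0.
apply: le_ereal_sup_tmp; exists (hausdorff_pre m 1 S); first by exists 1 => //=.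
apply: le_ereal_inf_tmp => _ [E [SE Ed] <-].
have /choice[g gE] := fun k => hausdorff_gauge_real m (Ed k).
pose a k := (2 ^+ m * g k / ball_volume R m) `^ m%:R^-1.
have g0 k : 0 <= g k by have [] := gE k.
have am k : a k ^+ m = 2 ^+ m * g k / ball_volume R m.
  rewrite -powR_mulrn ?powR_ge0// -powRrM mulVf ?pnatr_eq0 -?lt0n// powRr1//.
  by rewrite divr_ge0 ?(ltW bv)// mulr_ge0.
have diamE k x y : E k x -> E k y -> enorm (x - y) <= a k.
  move=> Ex Ey; have [_ _ /(_ _ _ Ex Ey) h] := gE k.
  rewrite -(@ler_pXn2r _ m) ?nnegrE ?powR_ge0 ?sqrtr_ge0// am.
  move: h; rewrite exprMn exprVn mulrA ler_pdivrMr ?exprn_gt0// mulrC.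
  by rewrite -ler_pdivlMr// [g k * _]mulrC.
have /choice[zc zcP] : forall k, exists w, forall z,
    `|z - z0| <= r -> E k (f z) -> `|z - w| <= C * a k.
  move=> k; have [[w wr Ew]|nE] := pselect (exists2 w, `|w - z0| <= r & E k (f w)); last first.
    by exists 0 => z zr Ez; case: nE; exists z.
  exists w => z zr Ez; rewrite (le_trans (fC _ _ zr wr))// ler_pM2l//.
  by rewrite (le_trans (norm_le_enorm _))// diamE.
pose rad k : 'rV[R]_m := const_mx (C * a k).
have Ca0 k : 0 <= C * a k by rewrite mulr_ge0 ?powR_ge0// ltW.
have := @box_cover_le R m (z0 - e) (z0 + e) xpredT
  (fun k => zc k - rad k) (fun k => zc k + rad k).
have h1 : forall i, (z0 - e) ord0 i <= (z0 + e) ord0 i.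
  by move=> i; rewrite !mxE lerD2l ge0_cp// ltW.
have h2 : forall k i, (zc k - rad k) ord0 i <= (zc k + rad k) ord0 i.
  by move=> k i; rewrite !mxE lerD2l ge0_cp.
have h3 x : box (z0 - e) (z0 + e) x ->
    exists2 k, true & box (zc k - rad k) (zc k + rad k) x.
  move=> xb; have xr : `|x - z0| <= r.
    apply: mx_norm_le => [|i j]; first exact: ltW.
    by rewrite (ord1 i) !mxE ler_distl; have := xb j; rewrite !mxE.
  have [k _ Ek] := SE _ (fS _ xr).
  exists k => // i; rewrite !mxE -ler_distl.
  have -> : x ord0 i - zc k ord0 i = (x - zc k) ord0 i by rewrite !mxE.
  by rewrite (le_trans (mx_coord_le _ _ _))// zcP.
move=> /(_ h1 h2 h3).
have -> : (\sum_(0 <= k <oo) (box_volume (zc k - rad k) (zc k + rad k))%:E =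
          c%:E * \sum_(0 <= k <oo) hausdorff_gauge m (E k))%E.
  rewrite -nneseriesZl; last by move=> k _; have [-> g_ge0 _] := gE k; rewrite lee_fin.
  apply: eq_eseriesr => k _; have [-> g_ge0 _] := gE k; rewrite -EFinM; congr EFin.
  rewrite /box_volume (eq_bigr (fun=> 2 * C * a k)); last first.
    by move=> i _; rewrite !mxE; ring.
  rewrite prodr_const card_ord exprMn am /c !exprMn.
  have -> : (4 : R) = 2 * 2 by ring.
  by rewrite exprMn; ring.
by rewrite -/V => h; rewrite mulrC EFinM lee_pdivrMl.
Qed.

(** * Rank of the jacobian of the ruled map *)

Lemma row_free_col_mx (F : fieldType) d n (v : 'rV[F]_n) (P : 'M[F]_(d, n)) :
  row_free P -> ~~ (v <= P)%MS -> row_free (col_mx v P).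
Proof.
move=> Pf vP; apply: inj_row_free => u.
rewrite -[u]hsubmxK mul_row_col [lsubmx u]mx11_scalar mul_scalar_mx.
set s := lsubmx u 0 0; have [->|s0] := eqVneq s 0.
  rewrite scale0r add0r => uP.
  have -> : rsubmx u = 0 by apply: (row_free_inj Pf); rewrite mul0mx.
  by rewrite raddf0 row_mx0.
move=> /eqP; rewrite addr_eq0 => /eqP E; case/negP: vP.
by rewrite -[v](scalerK s0) E scalemx_sub// -mulNmx submxMl.
Qed.

(** Let (Bl, Br) be a right inverse of the matrix with rows [h *m V] and [P].  On
the right of P + t V it gives 1 + t X in the block [Br], with X = V Br and
h X = 0.  For a vector (s, u') of the left kernel, the block [Br] says that
s / l h + u' is killed by 1 + t X, which is injective for small [t], so
u' = - s / l h; the block [Bl] then says that t s / l = 0. *)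
Lemma row_free_ruling (R : realType) d n (P V : 'M[R]_(d, n)) (v : 'rV[R]_n)
    (h : 'rV[R]_d) (l : R) :
  row_free P -> l != 0 -> h *m P = l *: v -> ~~ (h *m V <= P)%MS ->
  exists t, row_free (col_mx v (P + t *: V)).
Proof.
move=> Pf l0 hPv hV.
have /row_freeP[B NB] := row_free_col_mx Pf hV.
pose Bl : 'M[R]_(n, 1) := @lsubmx _ n 1 d B; pose Br : 'M[R]_(n, d) := @rsubmx _ n 1 d B.
have BE : B = row_mx Bl Br by rewrite hsubmxK.
move: NB; rewrite {}BE mul_col_row (scalar_mx_block 1 d).
move=> /eq_block_mx[hVl hVr Pl Pr].
have vl : v *m Bl = 0.
  by rewrite -[v](scalerK l0) -hPv -scalemxAl -mulmxA Pl mulmx0 scaler0.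
have vr : v *m Br = l^-1 *: h.
  by rewrite -[v](scalerK l0) -hPv -scalemxAl -mulmxA Pr mulmx1.
pose X := V *m Br.
have hX : h *m X = 0 by rewrite /X mulmxA.
pose K := d%:R * `|X| + 1.
have K0 : 0 < K by rewrite ltr_wpDl// mulr_ge0.
have Xinj (u : 'rV_d) : u + K^-1 *: (u *m X) = 0 -> u = 0.
  move=> /eqP; rewrite addr_eq0 => /eqP uE; apply/eqP; rewrite -normr_eq0.
  have : K * `|u| <= d%:R * `|X| * `|u|.
    rewrite {1}uE normrN normrZ gtr0_norm ?invr_gt0// mulrA divff ?gt_eqF// mul1r.
    exact: mulmx_norm_le.
  rewrite /K mulrDl mul1r gerDl => u0.
  by rewrite eq_le u0 normr_ge0.
exists K^-1; apply: inj_row_free => u.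
rewrite -[u]hsubmxK mul_row_col [lsubmx u]mx11_scalar mul_scalar_mx.
set s := lsubmx u 0 0; set u' := rsubmx u => uJ.
have : (s / l) *: h + u' = 0.
  apply: Xinj; have := congr1 (mulmx^~ Br) uJ.
  rewrite mul0mx mulmxDl -scalemxAl vr -mulmxA mulmxDl Pr -scalemxAl -/X => <-.
  rewrite mulmxDl -scalemxAl hX scaler0 add0r mulmxDr mulmx1 -scalemxAr scalerA.
  by rewrite addrA.
move=> /eqP; rewrite addrC addr_eq0 => /eqP u'E.
have := congr1 (mulmx^~ Bl) uJ.
rewrite mul0mx mulmxDl -scalemxAl vl scaler0 add0r -mulmxA mulmxDl Pl add0r.
rewrite u'E mulNmx -!scalemxAl -!scalemxAr mulmxA hVl !scalerA.
move=> /matrixP/(_ 0 0); rewrite !mxE mulr1n => /eqP.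
rewrite oppr_eq0 mulr1 !mulf_eq0 !invr_eq0 (negPf l0) (gt_eqF K0) !orbF => /eqP s0.
by rewrite s0 mul0r scale0r oppr0 raddf0 row_mx0.
Qed.

(** * Charts of the submanifold and of the bundle *)

(** The affine map y |-> (y - a) Q inverts the chart; in particular [Q] is a right
inverse of every jacobian of the chart, and it lifts curves of [M] to the domain
of the chart without loss of regularity. *)
Lemma graph_param_jacobian (R : realType) d n (M : set 'rV[R]_n) U psi :
  @graph_param R d n M U psi -> exists a (Q : 'M[R]_(n, d)),
    (forall y, (psi y - a) *m Q = y) /\
    forall x, U x -> exists P : 'M[R]_(d, n),
      P *m Q = 1%:M /\ strictly_differentiable_at psi x P.
Proof.
case=> oU _ [a [A [B [f [AA BB AB cf psiE]]]]].
have BA : B *m A^T = 0 by rewrite -[LHS]trmxK trmx_mul trmxK AB trmx0.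
exists a, A^T; split=> [y|x Ux].
  by rewrite psiE -[a + _ + _]addrA [a + _]addrC addrK mulmxDl -!mulmxA AA BA mulmx0 mulmx1 addr0.
exists (A + jacobian f x *m B); split; first by rewrite mulmxDl -mulmxA BA AA mulmx0 addr0.
have sf := C1_strictly_differentiable oU cf Ux.
move=> e e0.
have K0 : 0 < (n - d)%:R * `|B| + 1 by rewrite ltr_wpDl// mulr_ge0.
have [r r0 hr] := sf _ (divr_gt0 e0 K0); exists r => // y z yr zr.
have -> : psi y - psi z - (y - z) *m (A + jacobian f x *m B) =
    (f y - f z - (y - z) *m jacobian f x) *m B.
  rewrite !psiE mulmxDr mulmxA !mulmxBl.
  move: (_ *m B) (_ *m B) (_ *m B) (_ *m A) (_ *m A) => u v w s t.
  by apply/rowP => i; rewrite !mxE; ring.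
rewrite (le_trans (mulmx_norm_le _ _))//.
rewrite (le_trans (ler_wpM2l _ (hr _ _ yr zr)))//.
rewrite mulrA ler_wpM2r// mulrCA ler_piMr ?(ltW e0)// ler_pdivrMr ?mul1r//.
by rewrite lerDl.
Qed.

Lemma graph_param_tangent (R : realType) d n (M : set 'rV[R]_n) U psi x P
    (v : 'rV[R]_n) :
  @graph_param R d n M U psi -> U x -> strictly_differentiable_at psi x P ->
  (v <= P)%MS -> tangent_space d M (psi x) v.
Proof.
move=> gp Ux sP /submxP[h ->]; exists U, psi, x; split => //.
by exists h => //; rewrite (strictly_differentiable_diff sP).
Qed.

Definition local_section (R : realType) d n (phi : 'rV[R]_n -> projspace R n)
  (psi : 'rV[R]_d -> 'rV[R]_n) (i : 'I_n) (x : 'rV[R]_d) : 'rV[R]_n :=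
  affine_chart i (phi (psi x)).

Lemma affine_chart_in (R : realType) n (i : 'I_n) (L : projspace R n) :
  affine_chart i L \in val L.
Proof. by rewrite /affine_chart memvZ// memv_pick. Qed.

Lemma affine_dom_ex (R : realType) n (L : projspace R n) :
  exists i : 'I_n, affine_dom i L.
Proof.
have v0 : vpick (val L) != 0.
  by rewrite vpick0 -dimv_eq0 (eqP (valP L)).
have [i /= vi] : exists i, vpick (val L) ord0 i != 0.
  apply: contrapT => /forallNP vi; case/eqP: v0; apply/rowP => i.
  by rewrite [RHS]mxE; apply/eqP; apply/negPn/negP/vi.
by exists i.
Qed.

Lemma affine_chart_scale (R : realType) n (i : 'I_n) (L : projspace R n) v :
  affine_dom i L -> v \in val L -> v = v ord0 i *: affine_chart i L.
Proof.
rewrite /affine_dom/= => w0 vL.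
have : v \in <[vpick (val L)]>%VS.
  rewrite (_ : <[_]>%VS = val L)//; apply/eqP; rewrite -dimv_leqif_eq.
  - by rewrite dim_vline (eqP (valP L)) vpick0 -dimv_eq0 (eqP (valP L)).
  - by rewrite -memvE memv_pick.
move=> /vlineP[k ->]; rewrite /affine_chart scalerA mxE -mulrA divff// mulr1.
by [].
Qed.

(** Near [t0] the leaf stays in the chart, and its velocity is the multiple of the
section given by the i-th coordinate of the velocity, because the i-th
coordinate of the section is constantly 1.  So c' is a product of two
differentiable functions, and h is the velocity of the lift of [c]. *)
Lemma leaf_second_derivative (R : realType) d n (M : set 'rV[R]_n)
    (phi : 'rV[R]_n -> projspace R n) U psi x (i : 'I_n) P V a b c (t0 : R) :
  @graph_param R d n M U psi -> C1_line_bundle d M phi ->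
  U x -> affine_dom i (phi (psi x)) ->
  strictly_differentiable_at psi x P ->
  strictly_differentiable_at (local_section phi psi i) x V ->
  leaf_param M phi a b c -> a < t0 < b -> c t0 = psi x ->
  exists (h : 'rV[R]_d) (l m : R),
    [/\ l != 0, h *m P = l *: local_section phi psi i x,
      derive1 c t0 = l *: local_section phi psi i x &
      derive1n 2 c t0 = m *: local_section phi psi i x + l *: (h *m V)].
Proof.
move=> gp hphi Ux ix sP sV lc t0ab ct0.
have [oD _] := hphi _ _ gp i.
have [a0 [Q [psiQ _]]] := graph_param_jacobian gp.
have [oU [W oW MW] _] := gp.
set g := local_section phi psi i in sV *.
have [[dc dc' _] [_ c'0 _]] := lc _ t0ab.
pose X s := (c s - a0) *m Q.
have Xt0 : X t0 = x by rewrite /X ct0 psiQ.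
have sX := affine_strictly_differentiable a0 Q (c t0).
have [dX _] := derive_curve_comp dc sX.
have cX := differentiable_continuous ((derivable1_diffP X t0).1 dX).
have cc := differentiable_continuous ((derivable1_diffP c t0).1 dc).
have Wx : W (psi x).
  by have [] : (M `&` W) (psi x) by rewrite -MW; exists x.
have nW : \forall s \near t0, W (c s).
  by apply: cc; apply: open_nbhs_nbhs; rewrite ct0.
have nD : \forall s \near t0, affine_dom i (phi (psi (X s))).
  have : \forall y \near X t0, affine_dom i (phi (psi y)).
    have : open_nbhs (X t0) (U `&` [set y | affine_dom i (phi (psi y))]).
      by split; [exact: oD|rewrite Xt0].
    by move=> /open_nbhs_nbhs; apply: filterS => y [].
  exact: cX.
have nab : \forall s \near t0, a < s < b.
  by apply: filterS (near_in_itvoo (_ : t0 \in `]a, b[)) => [s|]; rewrite in_itv.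
have nc : \forall s \near t0, c s = psi (X s).
  near=> s.
  have sab : a < s < b by near: s.
  have [_ [Mc _ _]] := lc s sab.
  have [y Uy yc] : (psi @` U) (c s) by rewrite MW; split => //; near: s.
  by rewrite /X -yc psiQ.
exists (derive1 X t0), (derive1 c t0 ord0 i), (derive1 (fun s => derive1 c s ord0 i) t0).
have c'E : \forall s \near t0, derive1 c s = derive1 c s ord0 i *: g (X s).
  near=> s.
  have sab : a < s < b by near: s.
  have [_ [_ _ c'L]] := lc s sab.
  have csE : c s = psi (X s) by near: s.
  rewrite csE in c'L.
  by apply: affine_chart_scale => //; near: s.
have c'x : derive1 c t0 = derive1 c t0 ord0 i *: g x.
  by rewrite {1}(nbhs_singleton c'E) Xt0.
have sP' : strictly_differentiable_at psi (X t0) P by rewrite Xt0.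
have sV' : strictly_differentiable_at g (X t0) V by rewrite Xt0.
have [_ psi'] := derive_curve_comp dX sP'.
have [dg g'] := derive_curve_comp dX sV'.
have c'P : derive1 c t0 = derive1 X t0 *m P.
  by rewrite -psi' !derive1E; apply: near_eq_derive.
have dl := (derivable_mxP (derive1 c) t0 1).1 dc' ord0 i.
split => //.
- by apply: contraNneq c'0 => l0; rewrite c'x l0 scale0r.
- by rewrite -c'P.
- have -> : derive1n 2 c t0 = derive1 (fun s => derive1 c s ord0 i *: (g \o X) s) t0.
    by rewrite /derive1n/= !derive1E; apply: near_eq_derive.
  by rewrite derive_curveZ// g' /= Xt0.
Unshelve. all: by end_near. Qed.

(** Off the tangent spaces the rank is reached at t = 0.  Otherwise, if h V were
tangent at the points of every leaf, then c' and c'' would be tangent too, and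
the bundle would osculate. *)
Lemma full_rank_ruling (R : realType) n d (M : set 'rV[R]_n)
    (phi : 'rV[R]_n -> projspace R n) :
  C1_submanifold d M -> C1_line_bundle d M phi -> semi_generic d M phi ->
  exists U psi x i t J,
    [/\ @graph_param R d n M U psi, U x, affine_dom i (phi (psi x)),
      strictly_differentiable_at (ruled psi (local_section phi psi i))
        (row_mx t%:M x) J & row_free J].
Proof.
move=> [_ hM] hphi hsg.
have frame p : M p -> exists U psi x i P V,
    [/\ @graph_param R d n M U psi, U x, psi x = p,
        affine_dom i (phi (psi x)) &
      [/\ row_free P, strictly_differentiable_at psi x P &
        strictly_differentiable_at (local_section phi psi i) x V]].
  move=> /hM[U [psi [gp [x Ux xp]]]].
  have [i ix] := affine_dom_ex (phi (psi x)).
  have [a [Q [_ /(_ _ Ux)[P [PQ sP]]]]] := graph_param_jacobian gp.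
  have [oD cD] := hphi _ _ gp i.
  have sV := C1_strictly_differentiable oD cD (conj Ux ix).
  exists U, psi, x, i, P, (jacobian (local_section phi psi i) x); split => //.
  by split => //; apply/row_freeP; exists Q.
case: hsg => [ntan|[_ nosc]].
  have [p [u [Mp pu pT]]] : exists p u,
      [/\ M p, u \in val (phi p) & ~ tangent_space d M p u].
    apply: contrapT => nE; apply: ntan => p Mp u pu; apply: contrapT => pT.
    by apply: nE; exists p, u.
  have [U [psi [x [i [P [V [gp Ux xp ix [Pf sP sV]]]]]]]] := frame p Mp.
  exists U, psi, x, i, 0, (col_mx (local_section phi psi i x) (P + 0 *: V)).
  split => //; first exact: ruled_strictly_differentiable.
  rewrite scale0r addr0; apply: row_free_col_mx => //.
  apply/negP => vP; apply: pT; rewrite -xp.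
  apply: (graph_param_tangent gp Ux sP).
  by rewrite (affine_chart_scale ix (_ : u \in _)) ?xp// scalemx_sub// -xp.
apply: contrapT => nE; apply: nosc => p Mp a b t0 c lc t0ab ct0 u uc.
have [U [psi [x [i [P [V [gp Ux xp ix [Pf sP sV]]]]]]]] := frame p Mp.
have [h [l [m [l0 hP c1 c2]]]] :=
  leaf_second_derivative gp hphi Ux ix sP sV lc t0ab (etrans ct0 (esym xp)).
rewrite -xp; apply: (graph_param_tangent gp Ux sP).
have vP : (local_section phi psi i x <= P)%MS.
  by rewrite -[local_section _ _ _ _](scalerK l0) -hP scalemx_sub// submxMl.
have hV : (h *m V <= P)%MS.
  apply: contrapT => /negP hV; have [t Jf] := row_free_ruling Pf l0 hP hV.
  apply: nE; exists U, psi, x, i, t, (col_mx (local_section phi psi i x) (P + t *: V)).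
  by split => //; exact: ruled_strictly_differentiable.
have : u \in <<[:: derive1 c t0; derive1n 2 c t0]>>%VS := uc.
rewrite span_cons span_seq1 => /memv_addP[v /vlineP[k ->]].
move=> [w /vlineP[k' ->] ->].
rewrite c1 c2.
by apply: addmx_sub; apply: scalemx_sub; [|apply: addmx_sub]; apply: scalemx_sub.
Qed.

(** * Maps with a jacobian of full rank *)

(** A right inverse [B] of [J] turns the increment of [f] back into the increment
of the argument up to an error of at most half of it, which is absorbed by the
left-hand side. *)
Lemma strictly_differentiable_expanding (R : realType) p q
    (f : 'rV[R]_p -> 'rV[R]_q) z0 J :
  strictly_differentiable_at f z0 J -> row_free J ->
  exists C r, [/\ 0 < C, 0 < r & forall z z',
    `|z - z0| <= r -> `|z' - z0| <= r -> `|z - z'| <= C * `|f z - f z'|].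
Proof.
move=> sf /row_freeP[B JB].
pose K := q%:R * `|B| + 1.
have K0 : 0 < K by rewrite ltr_wpDl// mulr_ge0.
have KB (w : 'rV_q) : `|w *m B| <= K * `|w|.
  by rewrite (le_trans (mulmx_norm_le _ _))// ler_wpM2r// lerDl.
have e0 : 0 < (2 * K)^-1 by rewrite invr_gt0 mulr_gt0.
have [r r0 hr] := sf _ e0.
exists (2 * K), r; split => //; first by rewrite mulr_gt0.
move=> z z' zr zr'; have h := hr z z' zr zr'.
have : `|(z - z') *m J *m B| <= K * (`|f z - f z'| + (2 * K)^-1 * `|z - z'|).
  rewrite (le_trans (KB _))// ler_wpM2l ?(ltW K0)//.
  rewrite -[(z - z') *m J](subKr (f z - f z')).
  by apply: le_trans (ler_normB _ _) _; rewrite lerD2l.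
rewrite -mulmxA JB mulmx1 mulrDr mulrA invfM mulrCA divff ?gt_eqF// mulr1.
lra.
Qed.

(** Joins the completeness and the norm of row vectors, which Banach's fixed
point theorem needs together. *)
HB.instance Definition _ (R : realType) n := Complete.on 'rV[R]_n.

(** The surjectivity half of the inverse function theorem.  To solve f z = y,
iterate g z = z - (f z - y) J^-1, which is 1/2-Lipschitz near [z0] and maps a
closed ball to itself as soon as [y] is close to [f z0]. *)
Lemma strictly_differentiable_open_image (R : realType) n
    (f : 'rV[R]_n -> 'rV[R]_n) z0 J (A : set 'rV[R]_n) :
  strictly_differentiable_at f z0 J -> J \in unitmx -> nbhs z0 A ->
  nbhs (f z0) (f @` A).
Proof.
move=> sf Ju /nbhs_closedballP[rA rAP].
pose B := invmx J.
pose K := n%:R * `|B| + 1.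
have K0 : 0 < K by rewrite ltr_wpDl// mulr_ge0.
have KB (w : 'rV_n) : `|w *m B| <= K * `|w|.
  by rewrite (le_trans (mulmx_norm_le _ _))// ler_wpM2r// lerDl.
have e0 : 0 < (2 * K)^-1 by rewrite invr_gt0 mulr_gt0.
have [r1 r10 hr1] := sf _ e0.
pose r := Num.min r1 rA%:num.
have r0 : 0 < r by rewrite lt_min r10/=.
apply/nbhs_closedballP.
have s0 : 0 < r / (2 * K) by rewrite divr_gt0// mulr_gt0.
exists (PosNum s0) => y /=; rewrite closed_ballE// /closed_ball_/= => yr.
pose g z := z - (f z - y) *m B.
have glip z z' : `|z - z0| <= r -> `|z' - z0| <= r ->
    `|g z - g z'| <= 2^-1 * `|z - z'|.
  move=> zr zr'.
  have rr1 : r <= r1 by rewrite ge_min lexx.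
  have h := hr1 z z' (le_trans zr rr1) (le_trans zr' rr1).
  have -> : g z - g z' = - ((f z - f z' - (z - z') *m J) *m B).
    rewrite /g !mulmxBl -![_ *m J *m B]mulmxA !mulmxV// !mulmx1.
    move: (_ *m B) (_ *m B) (_ *m B) => a b c.
    by apply/rowP => i; rewrite !mxE; ring.
  rewrite normrN (le_trans (KB _))// (le_trans (ler_wpM2l (ltW K0) h))//.
  by rewrite mulrA invfM mulrCA divff ?gt_eqF// mulr1.
have gball z : `|z - z0| <= r -> `|g z - z0| <= r.
  move=> zr; rewrite -[g z](subrK (g z0)) -addrA (le_trans (ler_normD _ _))//.
  have -> : g z0 - z0 = - ((f z0 - y) *m B) by rewrite /g addrAC subrr add0r.
  have -> : r = 2^-1 * r + K * (r / (2 * K)) by field; rewrite gt_eqF.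
  rewrite lerD//; last by rewrite normrN (le_trans (KB _))// ler_pM2l.
  by rewrite (le_trans (glip _ _ _ _))// ?subrr ?normr0 ?ler_pM2l// ltW.
pose U : set 'rV[R]_n := closed_ball_ Num.norm z0 r.
have UE z : U z <-> `|z - z0| <= r by rewrite /U /closed_ball_/= distrC.
have gU : {homo g : z / U z >-> U z} by move=> z /UE zr; apply/UE/gball.
have [|||z Uz zE] := @banach_fixed_point R 'rV[R]_n U [the {fun U >-> U} of mkfun gU].
- exists (2^-1)%:nng; split => /=; first by rewrite invf_lt1 ?ltr1n.
  by move=> [z z'] /= [/UE ? /UE ?]; exact: glip.
- exact: closed_closed_ball_.
- by exists z0; apply/UE; rewrite subrr normr0 ltW.
exists z.
  apply: rAP; rewrite closed_ballE// /closed_ball_/=.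
  by rewrite (le_trans Uz)// ge_min lexx orbT.
have : (f z - y) *m B = 0.
  move/eqP: zE; rewrite /= /g eq_sym subr_eq -subr_eq0 opprD addrA subrr add0r.
  by rewrite oppr_eq0 => /eqP.
move=> /(congr1 (mulmx^~ J)); rewrite -mulmxA mulVmx// mulmx1 mul0mx.
by move/eqP; rewrite subr_eq0 => /eqP.
Qed.

(** * The theorem *)

Theorem theorem4p2p7 (R : realType) (n d : nat) (hd : (1 <= d <= n - 1)%N)
    (M : set 'rV[R]_n) (hM : C1_submanifold d M)
    (phi : 'rV[R]_n -> projspace R n) (hphi : C1_line_bundle d M phi)
    (hsg : semi_generic d M phi) :
  (0 < volume d.+1 (codiagonal @` bundle M phi))%E /\
  (d = (n - 1)%N -> interior (codiagonal @` bundle M phi) !=set0).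
Proof.
have [U [psi [x [i [t [J [gp Ux ix sF Jf]]]]]]] := full_rank_ruling hM hphi hsg.
set S := codiagonal @` bundle M phi.
set F := ruled psi (local_section phi psi i) in sF.
pose z0 : 'rV[R]_(1 + d) := row_mx t%:M x.
have [oD _] := hphi _ _ gp i.
have [rho rhoS] : exists rho : {posnum R}, forall z, `|z - z0| <= rho%:num -> S (F z).
  have : open_nbhs x (U `&` [set y | affine_dom i (phi (psi y))]) by split.
  move=> /open_nbhs_nbhs/nbhs_closedballP[rho rhoD].
  exists rho => z zr; set y := rsubmx z.
  have [Uy iy] : (U `&` [set y | affine_dom i (phi (psi y))]) y.
    apply: rhoD; rewrite closed_ballE// /closed_ball_/= distrC.
    rewrite (le_trans _ zr)// (le_trans _ (rsubmx_norm_le _))//.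
    by rewrite raddfB/= row_mxKr.
  exists (psi y, lsubmx z 0 0 *: local_section phi psi i y) => //; split => /=.
    by have [_ [W _ MW] _] := gp; have [] : (M `&` W) (psi y) by rewrite -MW; exists y.
  by rewrite memvZ// affine_chart_in.
have inner : n = d.+1 -> interior S !=set0.
  move=> nd; subst n; exists (F z0); rewrite /interior.
  have nA : nbhs z0 [set z | S (F z)].
    apply/nbhs_closedballP; exists rho => z; rewrite closed_ballE// /closed_ball_/= distrC.
    exact: rhoS.
  have := strictly_differentiable_open_image sF _ nA.
  rewrite row_free_unit in Jf => /(_ Jf); apply: filterS.
  by move=> _ [z Sz <-].
split; last first.
  move=> dn; apply: inner; rewrite dn subn1 prednK//.
  by move: hd; case: (n) => //; case: (d).
rewrite /volume; case: eqP => [nd|_].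
  exact/lebesgue_outer_gt0/inner.
have [C [r [C0 r0 FC]]] := strictly_differentiable_expanding sF Jf.
apply: (@hausdorff_measure_gt0 R d.+1 n F z0 C (Num.min r rho%:num)) => //.
- by rewrite lt_min r0/=.
- by move=> z z'; rewrite !le_min => /andP[zr _] /andP[zr' _]; exact: FC.
- by move=> z; rewrite le_min => /andP[_ zr]; exact: rhoS.
Qed.
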